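(* Let $\Gamma$ be a group, $R$ a $\Gamma$-graded ring, $\gamma\in C_\Gamma(\Gamma_R)$ and $\delta\in\mathrm{Der}_\gamma(R)$. Let $\mathcal{C}_\delta$ be the category whose objects are triples $(S,\varphi,u)$ consisting of a $\Gamma$-graded ring $S$, a graded ring homomorphism $\varphi:R\to S$, and an element $u\in S_\gamma$ such that $u\varphi(x)-\varphi(x)u=\varphi(\delta(x))$ for all $x\in R$, and whose morphisms $(S,\varphi,u)\to(S',\varphi',u')$ are the graded ring homomorphisms $h:S\to S'$ with $h\circ\varphi=\varphi'$ and $h(u)=u'$. Then $R[t;\delta]$, together with the inclusion $\iota:R\hookrightarrow R[t;\delta]$ and the element $t$, is an initial object of $\mathcal{C}_\delta$. In particular: (1) if $\delta_1,\delta_2\in\mathrm{Der}_\gamma(R)$ are conjugate, i.e. $\delta_2=\psi\circ\delta_1\circ\psi^{-1}$ for some graded ring automorphism $\psi$ of $R$, then $R[t;\delta_1]\cong_{\mathrm{gr}}R[t;\delta_2]$; (2) for every $r\in R_\gamma$, $R[t;\delta+\delta_r]\cong_{\mathrm{gr}}R[t;\delta]$, where $\delta_r(x)=rx-xr$; (3) for every $n\ge1$, $M_n(R)[t;\hat\delta]\cong_{\mathrm{gr}}M_n(R[t;\delta])$, where $\hat\delta((x_{ij}))=(\delta(x_{ij}))$ is the entrywise extension of $\delta$ to $M_n(R)$.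
   Context: Rings are associative with identity and ring homomorphisms are unital; $\Gamma$ is a (not necessarily abelian) group with identity $e$. A ring $R$ is $\Gamma$-graded if $R=\bigoplus_{\sigma\in\Gamma}R_\sigma$ with $R_\sigma R_\tau\subseteq R_{\sigma\tau}$ and $1_R\in R_e$; its support is $\Gamma_R=\{\sigma:R_\sigma\ne0\}$, and $C_\Gamma(\Gamma_R)$ is the centralizer of $\Gamma_R$ in $\Gamma$. A ring homomorphism $f:R\to S$ of $\Gamma$-graded rings is graded if $f(R_\sigma)\subseteq S_\sigma$ for all $\sigma$; $\cong_{\mathrm{gr}}$ denotes existence of a bijective graded ring homomorphism. $\mathrm{Der}_\gamma(R)$ is the set of additive maps $\delta:R\to R$ satisfying $\delta(xy)=\delta(x)y+x\delta(y)$ and $\delta(R_\tau)\subseteq R_{\tau\gamma}$ for all $\tau\in\Gamma_R$. $R[t;\delta]$ is the free left $R$-module on $\{t^k\}_{k\ge0}$ with multiplication determined by $tx=xt+\delta(x)$; for $\gamma\in C_\Gamma(\Gamma_R)$ and $\delta\in\mathrm{Der}_\gamma(R)$ it is $\Gamma$-graded by $R[t;\delta]_\tau=\bigoplus_{i\ge0}R_{\tau\gamma^{-i}}t^i$, so $\deg(t)=\gamma$. For a $\Gamma$-graded ring $A$, the matrix ring $M_n(A)$ is graded by $M_n(A)_\tau=M_n(A_\tau)$. *)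

(* Defs.v *)
From HB Require Import structures.
From mathcomp Require Import all_boot all_algebra.
From mathcomp Require Import finmap.
From mathcomp Require Import monalg.

Set Implicit Arguments.
Unset Strict Implicit.
Unset Printing Implicit Defensive.

Import GRing.Theory.
Local Open Scope ring_scope.

(* Rings are [pzRingType]s: the zero ring is allowed.  Homogeneous components
   are arbitrary subsets (Prop-valued predicates), as they need not be
   decidable. *)
Record grading (Γ : groupType) (R : pzRingType) (G : Γ -> R -> Prop) : Prop :=
  Grading {
  grading0 : forall σ, G σ 0;
  gradingB : forall σ x y, G σ x -> G σ y -> G σ (x - y);
  grading_sum : forall x, exists s : seq R,
    (forall y, y \in s -> exists σ, G σ y) /\ x = \sum_(y <- s) y;
  grading_direct : forall (s : seq Γ) (f : Γ -> R), uniq s ->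
    (forall σ, G σ (f σ)) -> \sum_(σ <- s) f σ = 0 ->
    forall σ, σ \in s -> f σ = 0;
  gradingM : forall σ τ x y, G σ x -> G τ y -> G (σ * τ)%g (x * y);
  grading1 : G 1%g 1 }.

Record gradedRing (Γ : groupType) := GradedRing {
  gr_ring :> pzRingType;
  gr_comp : Γ -> gr_ring -> Prop;
  gr_grading : grading gr_comp }.

Arguments gr_comp {Γ} R σ x : rename.

Definition gr_supp (Γ : groupType) (R : gradedRing Γ) (σ : Γ) : Prop :=
  exists2 x, gr_comp R σ x & x != 0.

Definition gr_cent (Γ : groupType) (R : gradedRing Γ) (γ : Γ) : Prop :=
  forall σ, gr_supp R σ -> commute γ σ.

Record grHom (Γ : groupType) (R S : gradedRing Γ) := GrHom {
  grHom_rmorphism :> {rmorphism R -> S};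
  grHom_comp : forall σ x,
    gr_comp R σ x -> gr_comp S σ (grHom_rmorphism x) }.

Definition gr_iso (Γ : groupType) (R S : gradedRing Γ) : Prop :=
  exists f : grHom R S, bijective f.

Definition grHom_id (Γ : groupType) (R : gradedRing Γ) : grHom R R :=
  @GrHom Γ R R idfun (fun σ x Rx => Rx).

Definition grHom_o (Γ : groupType) (R S T : gradedRing Γ)
    (g : grHom S T) (f : grHom R S) : grHom R T :=
  @GrHom Γ R T (g \o f) (fun σ x Rx => grHom_comp g (grHom_comp f Rx)).

Record derivation (R : pzRingType) := Derivation {
  der_additive :> {additive R -> R};
  der_leibniz : forall x y,
    der_additive (x * y) = der_additive x * y + x * der_additive y }.

Record grDer (Γ : groupType) (R : gradedRing Γ) (γ : Γ) := GrDer {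
  grDer_der :> derivation R;
  grDer_comp : forall τ, gr_supp R τ ->
    forall x, gr_comp R τ x -> gr_comp R (τ * γ)%g (grDer_der x) }.

Section GradedTheory.
Variables (Γ : groupType) (R : gradedRing Γ).

Lemma gr_comp0 σ : gr_comp R σ 0. Proof. exact: (grading0 (gr_grading R)). Qed.

Lemma gr_compB σ x y : gr_comp R σ x -> gr_comp R σ y -> gr_comp R σ (x - y).
Proof. exact: (gradingB (gr_grading R)). Qed.

Lemma gr_compN σ x : gr_comp R σ x -> gr_comp R σ (- x).
Proof. by move=> Rx; rewrite -sub0r; apply: gr_compB => //; apply: gr_comp0. Qed.

Lemma gr_compD σ x y : gr_comp R σ x -> gr_comp R σ y -> gr_comp R σ (x + y).
Proof. by move=> Rx /gr_compN Ry; rewrite -[y]opprK; apply: gr_compB. Qed.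

Lemma gr_comp_sum σ (I : eqType) (s : seq I) (P : pred I) (F : I -> R) :
  (forall i, i \in s -> P i -> gr_comp R σ (F i)) ->
  gr_comp R σ (\sum_(i <- s | P i) F i).
Proof.
move=> RF; rewrite big_seq_cond.
apply: (big_ind (gr_comp R σ)); first exact: gr_comp0.
  by move=> x y; apply: gr_compD.
by move=> i /andP[si Pi]; apply: RF.
Qed.

Lemma gr_compM σ τ x y :
  gr_comp R σ x -> gr_comp R τ y -> gr_comp R (σ * τ)%g (x * y).
Proof. exact: (gradingM (gr_grading R)). Qed.

Lemma gr_comp1 : gr_comp R 1%g 1. Proof. exact: (grading1 (gr_grading R)). Qed.

Lemma grDer_homog γ (δ : grDer R γ) τ x :
  gr_comp R τ x -> gr_comp R (τ * γ)%g (δ x).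
Proof.
move=> Rx; have [->|nx] := eqVneq x 0; first by rewrite raddf0; apply: gr_comp0.
by apply: grDer_comp => //; exists x.
Qed.

End GradedTheory.

(* R[t; δ]: the free left R-module on the t^k, i.e. the finitely supported
   families of coefficients; p@_k is the coefficient of t^k.  (The product put
   here on this alias is unrelated to the monoid-algebra product.) *)
Definition skew_poly (R : pzRingType) (δ : derivation R) : Type :=
  {malg R[nat]}.

Section SkewPoly.
Variables (R : pzRingType) (δ : derivation R).
Local Notation P := (skew_poly δ).

HB.instance Definition _ := GRing.Zmodule.copy P {malg R[nat]}.

Implicit Types (p q : P) (a b : R).

Definition skewZ a p : P :=
  \sum_(j <- msupp p) << a * p@_j *g j >>.

(* Left multiplication by t: t (b t^j) = b t^(j+1) + δ(b) t^j. *)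
Definition skewT p : P :=
  \sum_(j <- msupp p) (<< p@_j *g j.+1 >> + << δ (p@_j) *g j >>).

Definition skew_mul p q : P :=
  \sum_(i <- msupp p) skewZ p@_i (iter i skewT q).

Definition skew_C a : P := << a *g 0%N >>.
Definition skew_X : P := << 1 *g 1%N >>.

Lemma skewP p q : (forall k, p@_k = q@_k) -> p = q.
Proof. by move/malgP. Qed.

Lemma skew_sumE p : p = \sum_(k <- msupp p) (<< p@_k *g k >> : P).
Proof. exact: (monalgEw (fsubset_refl _)). Qed.

Lemma coef_sum (I : Type) (s : seq I) (F : I -> P) k :
  (\sum_(i <- s) F i)@_k = \sum_(i <- s) (F i)@_k.
Proof. exact: (raddf_sum (mcoeff k)). Qed.

Lemma coefD p q k : (p + q)@_k = p@_k + q@_k.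
Proof. exact: mcoeffD. Qed.

Lemma coef_pick (f : R -> R) p k : f 0 = 0 ->
  \sum_(j <- msupp p) f p@_j *+ (j == k) = f p@_k.
Proof.
move=> f0; have [kp|kp] := msuppP p k.
  rewrite (big_fsetD1 k) //= eqxx big1_fset ?addr0 // => j.
  by rewrite in_fsetD1; case: eqP.
rewrite f0 big1_fset // => j jp _; case: eqP => // jk.
by rewrite -jk jp in kp.
Qed.

Lemma coefZ a p k : (skewZ a p)@_k = a * p@_k.
Proof.
rewrite coef_sum -(@coef_pick ( *%R a)) ?mulr0 //.
by apply: eq_bigr => j _; rewrite mcoeffU.
Qed.

Lemma coefT p k :
  (skewT p)@_k = (if k is k'.+1 then p@_k' else 0) + δ (p@_k).
Proof.
rewrite coef_sum -(coef_pick _ _ (raddf0 δ)).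
under eq_bigr do rewrite coefD !mcoeffU.
rewrite big_split /=; congr (_ + _); case: k => [|k].
  by rewrite big1.
by rewrite -[RHS](@coef_pick id) //.
Qed.

Lemma skewZDr a : {morph skewZ a : p q / p + q}.
Proof. by move=> p q; apply: skewP => k; rewrite coefD !coefZ coefD mulrDr. Qed.

Lemma skewZDl p : {morph skewZ^~ p : a b / a + b}.
Proof. by move=> a b; apply: skewP => k; rewrite coefD !coefZ mulrDl. Qed.

Lemma skewZ0r a : skewZ a 0 = 0.
Proof. by apply: skewP => k; rewrite coefZ !mcoeff0 mulr0. Qed.

Lemma skewZ0l p : skewZ 0 p = 0.
Proof. by apply: skewP => k; rewrite coefZ mcoeff0 mul0r. Qed.

Lemma skewZZ a b p : skewZ a (skewZ b p) = skewZ (a * b) p.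
Proof. by apply: skewP => k; rewrite !coefZ mulrA. Qed.

Lemma skewZ1 p : skewZ 1 p = p.
Proof. by apply: skewP => k; rewrite coefZ mul1r. Qed.

Lemma skewZU a b k : skewZ a << b *g k >> = << a * b *g k >>.
Proof. by apply: skewP => j; rewrite coefZ !mcoeffU mulrnAr. Qed.

Lemma skewT0 : skewT 0 = 0.
Proof.
by apply: skewP => -[|k]; rewrite coefT !mcoeff0 raddf0 addr0.
Qed.

Lemma skewTD : {morph skewT : p q / p + q}.
Proof.
move=> p q; apply: skewP => -[|k]; rewrite coefD !coefT !coefD raddfD /=.
  by rewrite !add0r.
by rewrite addrACA.
Qed.

Lemma skewTU b k : skewT << b *g k >> = << b *g k.+1 >> + << δ b *g k >>.
Proof.
by apply: skewP => -[|j]; rewrite coefT coefD !mcoeffU raddfMn.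
Qed.

Lemma skewTZ a p : skewT (skewZ a p) = skewZ a (skewT p) + skewZ (δ a) p.
Proof.
apply: skewP => k; rewrite coefD coefT !coefZ coefT der_leibniz mulrDr.
by rewrite -addrA [X in _ + X]addrC; case: k => [|k]; rewrite ?coefZ ?mulr0.
Qed.

Lemma iterT0 i : iter i skewT 0 = 0.
Proof. by elim: i => //= i ->; rewrite skewT0. Qed.

Lemma iterTD i : {morph iter i skewT : p q / p + q}.
Proof. by move=> p q; elim: i => //= i ->; rewrite skewTD. Qed.

Lemma skew_mulEw (d : {fset nat}) p q : (msupp p `<=` d)%fset ->
  skew_mul p q = \sum_(i <- d) skewZ p@_i (iter i skewT q).
Proof.
move=> pd; apply: big_fset_incl => // i _ ip.
by rewrite mcoeff_outdom // skewZ0l.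
Qed.

Lemma skew_mulDl : left_distributive skew_mul +%R.
Proof.
move=> p1 p2 q; set d := (msupp p1 `|` msupp p2)%fset.
rewrite !(@skew_mulEw d) ?fsubsetUl ?fsubsetUr ?msuppD_le // -big_split /=.
by apply: eq_bigr => i _; rewrite coefD skewZDl.
Qed.

Lemma skew_mulDr : right_distributive skew_mul +%R.
Proof.
move=> p q1 q2; rewrite -big_split /=.
by apply: eq_bigr => i _; rewrite iterTD skewZDr.
Qed.

Lemma skew_mul0l q : skew_mul 0 q = 0.
Proof. by rewrite /skew_mul msupp0 big_seq_fset0. Qed.

Lemma skew_mul0r p : skew_mul p 0 = 0.
Proof. by rewrite /skew_mul big1 // => i _; rewrite iterT0 skewZ0r. Qed.

Lemma skew_mulU a i q : skew_mul << a *g i >> q = skewZ a (iter i skewT q).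
Proof.
rewrite (skew_mulEw _ msuppU_le) big_seq_fset1.
by rewrite mcoeffUU.
Qed.

Lemma skew_ind (Q : P -> Prop) : Q 0 ->
  (forall p q, Q p -> Q q -> Q (p + q)) ->
  (forall a k, Q << a *g k >>) -> forall p, Q p.
Proof.
by move=> Q0 QD QU p; rewrite [p]skew_sumE; apply: (big_ind Q).
Qed.

Lemma skew_mulZ a p q : skew_mul (skewZ a p) q = skewZ a (skew_mul p q).
Proof.
elim/skew_ind: p => [|p1 p2 IH1 IH2|b k].
- by rewrite skewZ0r !skew_mul0l skewZ0r.
- by rewrite skewZDr !skew_mulDl IH1 IH2 skewZDr.
- by rewrite skewZU !skew_mulU skewZZ.
Qed.

Lemma skew_mulT p q : skew_mul (skewT p) q = skewT (skew_mul p q).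
Proof.
elim/skew_ind: p => [|p1 p2 IH1 IH2|b k].
- by rewrite skewT0 !skew_mul0l skewT0.
- by rewrite skewTD !skew_mulDl IH1 IH2 skewTD.
- by rewrite skewTU skew_mulDl !skew_mulU skewTZ.
Qed.

Lemma skew_mulA : associative skew_mul.
Proof.
move=> p q r; elim/skew_ind: p => [|p1 p2 IH1 IH2|b k].
- by rewrite !skew_mul0l.
- by rewrite !skew_mulDl IH1 IH2.
- rewrite !skew_mulU skew_mulZ; congr skewZ.
  by elim: k => //= k ->; rewrite skew_mulT.
Qed.

Lemma skew_mul1l : left_id (skew_C 1) skew_mul.
Proof. by move=> q; rewrite skew_mulU /= skewZ1. Qed.

Lemma der1 : δ 1 = 0.
Proof.
have := der_leibniz δ 1 1; rewrite !mulr1 mul1r => /esym/eqP.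
by rewrite -[X in _ == X]addr0 (inj_eq (addrI _)) => /eqP.
Qed.

Lemma iterT1 i : iter i skewT (skew_C 1) = << 1 *g i >>.
Proof.
by elim: i => //= i ->; rewrite skewTU der1 monalgU0 addr0.
Qed.

Lemma skew_mul1r : right_id (skew_C 1) skew_mul.
Proof.
move=> p; rewrite [RHS]skew_sumE; apply: eq_bigr => i _.
by rewrite iterT1 skewZU mulr1.
Qed.

HB.instance Definition _ := GRing.Zmodule_isPzRing.Build P
  skew_mulA skew_mul1l skew_mul1r skew_mulDl skew_mulDr.

HB.instance Definition _ := GRing.Zmodule_isLmodule.Build R P
  skewZZ skewZ1 skewZDr skewZDl.

Lemma skew_C_additive : zmod_morphism skew_C.
Proof. by move=> a b; apply: monalgUB. Qed.

HB.instance Definition _ := GRing.isZmodMorphism.Build R P skew_C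
  skew_C_additive.

Lemma skew_C_monoid : monoid_morphism skew_C.
Proof.
split=> // a b; rewrite -[LHS](skewZU a b 0).
by rewrite [RHS](skew_mulU a 0).
Qed.

HB.instance Definition _ := GRing.isMonoidMorphism.Build R P skew_C
  skew_C_monoid.

Lemma skew_CX a i : skew_C a * skew_X ^+ i = << a *g i >> :> P.
Proof.
have -> : skew_X ^+ i = << 1 *g i >> :> P.
  elim: i => // i IH; rewrite exprS IH.
  rewrite [LHS](skew_mulU 1 1) /= skewZ1 skewTU der1 monalgU0.
  by rewrite addr0.
by rewrite [LHS](skew_mulU a 0) /= skewZU mulr1.
Qed.

Lemma skew_polyE p : p = \sum_(k <- msupp p) skew_C p@_k * skew_X ^+ k.
Proof.
rewrite [LHS]skew_sumE; apply: eq_bigr => k _.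
by rewrite skew_CX.
Qed.

Lemma skew_scaleE a p : a *: p = skew_C a * p.
Proof. by rewrite [RHS](skew_mulU a 0). Qed.

Lemma skew_XC a : skew_X * skew_C a = skew_C a * skew_X + skew_C (δ a).
Proof.
have /= := skew_CX a 1; rewrite expr1 => ->.
rewrite [LHS](skew_mulU 1 1) /= skewZ1 [LHS]skewTU.
by [].
Qed.

End SkewPoly.

Arguments skew_C {R} δ a.
Arguments skew_X {R} δ.

Section GradedSkewPoly.
Variables (Γ : groupType) (R : gradedRing Γ) (γ : Γ).
Hypothesis γC : gr_cent R γ.
Variable δ : grDer R γ.

Definition skew_comp (τ : Γ) (p : skew_poly δ) : Prop :=
  forall i, gr_comp R (τ * γ ^- i)%g p@_i.

Lemma skew_comp0 τ : skew_comp τ 0.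
Proof. by move=> i; rewrite mcoeff0; apply: gr_comp0. Qed.

Lemma skew_compB τ p q :
  skew_comp τ p -> skew_comp τ q -> skew_comp τ (p - q).
Proof. by move=> Pp Pq i; rewrite mcoeffB; apply: gr_compB. Qed.

Lemma skew_comp_sum τ (I : eqType) (s : seq I) (F : I -> skew_poly δ) :
  (forall i, i \in s -> skew_comp τ (F i)) ->
  skew_comp τ (\sum_(i <- s) F i).
Proof.
by move=> PF k; rewrite coef_sum; apply: gr_comp_sum => i si _; apply: PF.
Qed.

Lemma skew_compU σ a i :
  gr_comp R σ a -> skew_comp (σ * γ ^+ i)%g << a *g i >>.
Proof.
move=> Ra k; rewrite mcoeffU; case: eqVneq => [<-|_].
  by rewrite mulr1n mulgK.
exact: gr_comp0.
Qed.

Lemma skew_compT τ p : skew_comp τ p -> skew_comp (τ * γ)%g (skewT p).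
Proof.
move=> Pp k; rewrite coefT; apply: gr_compD.
  case: k => [|k]; first exact: gr_comp0.
  by rewrite expgSr mulgKA.
have -> : (τ * γ * γ ^- k = τ * γ ^- k * γ)%g.
  by rewrite -!mulgA; congr (_ * _)%g; apply/commuteV/commuteX.
exact: grDer_homog.
Qed.

Lemma skew_comp_iterT τ p i :
  skew_comp τ p -> skew_comp (τ * γ ^+ i)%g (iter i (@skewT R δ) p).
Proof.
move=> Pp; elim: i => [|i IH] /=; first by rewrite mulg1.
by rewrite expgSr mulgA; apply: skew_compT.
Qed.

Lemma skew_compZ σ τ a p :
  gr_comp R σ a -> skew_comp τ p -> skew_comp (σ * τ)%g (skewZ a p).
Proof.
by move=> Ra Pp i; rewrite coefZ -mulgA; apply: gr_compM.
Qed.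

Lemma skew_compM σ τ p q :
  skew_comp σ p -> skew_comp τ q -> skew_comp (σ * τ)%g (p * q).
Proof.
move=> Pp Pq; have [->|/eqP q0] := eqVneq q 0.
  by rewrite mulr0; apply: skew_comp0.
have cγτ : commute γ τ.
  have [k qk] : exists k, q@_k != 0.
    case: (fset_0Vmem (msupp q)) => [q_0|[k kq]]; last first.
      by exists k; rewrite mcoeff_neq0.
    case: q0; apply: skewP => k; rewrite mcoeff0.
    by apply: mcoeff_outdom; rewrite q_0.
  have /γC cγ : gr_supp R (τ * γ ^- k)%g by exists q@_k.
  rewrite -[τ](mulgVK (γ ^+ k)%g); apply: commuteM => //.
  exact/commuteX/commute_refl.
apply: skew_comp_sum => i _.
have -> : (σ * τ = (σ * γ ^- i) * (τ * γ ^+ i))%g.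
  rewrite (commuteX i (commute_sym cγτ)) mulgA.
  by rewrite mulgVK.
by apply: skew_compZ => //; apply: skew_comp_iterT.
Qed.

Lemma skew_comp1 : skew_comp 1%g 1.
Proof.
move=> i; rewrite [in X in gr_comp _ _ X]/GRing.one /= mcoeffU.
case: eqVneq => [<-|_]; last exact: gr_comp0.
by rewrite expg0 invg1 mulg1; apply: gr_comp1.
Qed.

Lemma skew_comp_span p : exists s : seq (skew_poly δ),
  (forall y, y \in s -> exists τ, skew_comp τ y) /\ p = \sum_(y <- s) y.
Proof.
elim/skew_ind: p => [|p q [sp [Hp ->]] [sq [Hq ->]]|a k].
- by exists [::]; split=> //; rewrite big_nil.
- exists (sp ++ sq); split; last by rewrite big_cat.
  by move=> y; rewrite mem_cat => /orP[/Hp|/Hq].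
have [s [Hs ->]] := grading_sum (gr_grading R) a.
exists [seq << b *g k >> | b <- s]; split.
  move=> _ /mapP[b /Hs[σ Rb] ->]; exists (σ * γ ^+ k)%g.
  exact: skew_compU.
by rewrite big_map raddf_sum.
Qed.

Lemma skew_comp_direct (s : seq Γ) (f : Γ -> skew_poly δ) : uniq s ->
  (forall τ, skew_comp τ (f τ)) -> \sum_(τ <- s) f τ = 0 ->
  forall τ, τ \in s -> f τ = 0.
Proof.
move=> us Pf f0 τ sτ; apply: skewP => k; rewrite mcoeff0.
have inj : injective (fun σ : Γ => σ * γ ^- k)%g by apply: mulIg.
pose g σ := (f (σ * γ ^+ k)%g)@_k.
have gE σ : g (σ * γ ^- k)%g = (f σ)@_k by rewrite /g mulgVK.
rewrite -gE.
apply: (grading_direct (gr_grading R) (s := [seq (σ * γ ^- k)%g | σ <- s])).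
- by rewrite map_inj_uniq.
- by move=> σ; have := Pf (σ * γ ^+ k)%g k; rewrite mulgK.
- rewrite big_map; under eq_bigr do rewrite gE.
  by rewrite -coef_sum f0 mcoeff0.
- exact: map_f.
Qed.

Lemma skew_grading : grading skew_comp.
Proof.
split.
- exact: skew_comp0.
- exact: skew_compB.
- exact: skew_comp_span.
- exact: skew_comp_direct.
- exact: skew_compM.
- exact: skew_comp1.
Qed.

Definition gr_ore : gradedRing Γ := GradedRing skew_grading.

Lemma skew_C_comp σ a : gr_comp R σ a -> gr_comp gr_ore σ (skew_C δ a).
Proof. by move=> Ra; have := skew_compU 0 Ra; rewrite mulg1. Qed.

Definition ore_incl : grHom R gr_ore := @GrHom Γ R gr_ore (skew_C δ) skew_C_comp.

Definition ore_var : gr_ore := skew_X δ.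

Lemma ore_var_comp : gr_comp gr_ore γ ore_var.
Proof. by have := skew_compU 1 (gr_comp1 R); rewrite mul1g. Qed.

Lemma ore_var_commutator x :
  ore_var * ore_incl x - ore_incl x * ore_var = ore_incl (δ x).
Proof. by rewrite /= skew_XC addrAC subrr add0r. Qed.

End GradedSkewPoly.

Section MatrixGrading.
Variables (Γ : groupType) (R : gradedRing Γ) (n : nat).

Definition mx_comp (τ : Γ) (A : 'M[R]_n) : Prop :=
  forall i j, gr_comp R τ (A i j).

Lemma mx_grading : grading mx_comp.
Proof.
split.
- by move=> σ i j; rewrite mxE; apply: gr_comp0.
- by move=> σ A B RA RB i j; rewrite !mxE; apply: gr_compB.
- move=> A.
  have cat : forall (B C : 'M[R]_n),
      (exists s : seq 'M[R]_n, (forall y, y \in s -> exists σ, mx_comp σ y)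
         /\ B = \sum_(y <- s) y) ->
      (exists s : seq 'M[R]_n, (forall y, y \in s -> exists σ, mx_comp σ y)
         /\ C = \sum_(y <- s) y) ->
      exists s : seq 'M[R]_n, (forall y, y \in s -> exists σ, mx_comp σ y)
         /\ B + C = \sum_(y <- s) y.
    move=> B C [sB [HB ->]] [sC [HC ->]].
    exists (sB ++ sC); split; last by rewrite big_cat.
    by move=> y; rewrite mem_cat => /orP[/HB|/HC].
  have nil : exists s : seq 'M[R]_n,
      (forall y, y \in s -> exists σ, mx_comp σ y) /\ 0 = \sum_(y <- s) y.
    by exists [::]; split=> //; rewrite big_nil.
  rewrite [A]matrix_sum_delta.
  apply: (big_ind _ nil cat) => i _; apply: (big_ind _ nil cat) => j _.
  have [s [Hs ->]] := grading_sum (gr_grading R) (A i j).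
  exists [seq y *: delta_mx i j | y <- s]; split; last first.
    by rewrite big_map scaler_suml.
  move=> _ /mapP[y /Hs[σ Ry] ->]; exists σ => k l; rewrite !mxE.
  by case: (_ && _); rewrite ?mulr1 ?mulr0 //; apply: gr_comp0.
- move=> s f us Rf f0 σ sσ; apply/matrixP => i j; rewrite mxE.
  apply: (grading_direct (gr_grading R) us (f := fun σ => f σ i j)) => //.
    by move=> τ; apply: Rf.
  by have /matrixP/(_ i j) := f0; rewrite summxE mxE.
- move=> σ τ A B RA RB i j; rewrite -mulmxE mxE.
  by apply: gr_comp_sum => k _ _; apply: gr_compM.
- move=> i j; rewrite mxE; case: eqVneq => _; first exact: gr_comp1.
  exact: gr_comp0.
Qed.

Definition gr_mx : gradedRing Γ := GradedRing mx_grading.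

Lemma gr_mx_cent γ : gr_cent R γ -> gr_cent gr_mx γ.
Proof.
move=> γC σ [A RA nA]; apply: γC.
have [i [j nij]] : exists i j, A i j != 0.
  exact/matrix0Pn.
by exists (A i j).
Qed.

Lemma map_mx_leibniz (δ : derivation R) (A B : 'M[R]_n) :
  map_mx δ (A * B) = map_mx δ A * B + A * map_mx δ B.
Proof.
apply/matrixP => i j; rewrite -!mulmxE !mxE raddf_sum -big_split /=.
by apply: eq_bigr => k _; rewrite der_leibniz !mxE.
Qed.

Definition mx_derivation (δ : derivation R) : derivation gr_mx :=
  @Derivation gr_mx (map_mx δ) (map_mx_leibniz δ).

Lemma mx_der_comp γ (δ : grDer R γ) τ : gr_supp gr_mx τ ->
  forall A, gr_comp gr_mx τ A ->
  gr_comp gr_mx (τ * γ)%g (mx_derivation δ A).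
Proof. by move=> _ A RA i j; rewrite mxE; apply: grDer_homog. Qed.

Definition mx_der γ (δ : grDer R γ) : grDer gr_mx γ := GrDer (mx_der_comp δ).

End MatrixGrading.

Section InnerDerivation.
Variable R : pzRingType.

Definition inner_fun (r x : R) : R := r * x - x * r.

Lemma inner_fun_additive r : zmod_morphism (inner_fun r).
Proof.
move=> x y; rewrite /inner_fun mulrBr mulrBl !opprB addrACA [RHS]addrACA.
by congr (_ + _); apply: addrC.
Qed.

HB.instance Definition _ r :=
  GRing.isZmodMorphism.Build R R (inner_fun r) (inner_fun_additive r).

Lemma inner_fun_leibniz r x y :
  inner_fun r (x * y) = inner_fun r x * y + x * inner_fun r y.
Proof. by rewrite /inner_fun mulrBr mulrBl !mulrA subrKA. Qed.

Definition inner_der (r : R) : derivation R :=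
  @Derivation R (inner_fun r) (inner_fun_leibniz r).

Lemma add_der_leibniz (δ1 δ2 : derivation R) (x y : R) :
  (δ1 \+ δ2) (x * y) = (δ1 \+ δ2) x * y + x * (δ1 \+ δ2) y.
Proof. by rewrite /= !der_leibniz mulrDl mulrDr addrACA. Qed.

Definition add_der (δ1 δ2 : derivation R) : derivation R :=
  @Derivation R (δ1 \+ δ2) (add_der_leibniz δ1 δ2).

End InnerDerivation.

Section GradedInnerDerivation.
Variables (Γ : groupType) (R : gradedRing Γ) (γ : Γ).

Lemma inner_grDer_comp (γC : gr_cent R γ) r (Rr : gr_comp R γ r) τ :
  gr_supp R τ ->
  forall x, gr_comp R τ x -> gr_comp R (τ * γ)%g (inner_der r x).
Proof.
move=> /γC cγτ x Rx; apply: gr_compB; last exact: gr_compM.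
by rewrite -cγτ; apply: gr_compM.
Qed.

Definition inner_grDer (γC : gr_cent R γ) r (Rr : gr_comp R γ r) : grDer R γ :=
  GrDer (inner_grDer_comp γC Rr).

Lemma add_grDer_comp (δ1 δ2 : grDer R γ) τ : gr_supp R τ ->
  forall x, gr_comp R τ x -> gr_comp R (τ * γ)%g (add_der δ1 δ2 x).
Proof. by move=> _ x Rx; apply: gr_compD; apply: grDer_homog. Qed.

Definition add_grDer (δ1 δ2 : grDer R γ) : grDer R γ :=
  GrDer (add_grDer_comp δ1 δ2).

Definition gr_conjugate (δ1 δ2 : grDer R γ) : Prop :=
  exists (ψ : grHom R R) (ψ' : R -> R),
    [/\ cancel ψ ψ', cancel ψ' ψ & δ2 =1 ψ \o δ1 \o ψ'].

End GradedInnerDerivation.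

(* Equality of morphisms is carried as an equivalence relation, so that no
   extensionality axiom is needed to compare bundled homomorphisms. *)
Record category := Category {
  cat_obj :> Type;
  cat_hom : cat_obj -> cat_obj -> Type;
  cat_eq : forall X Y, cat_hom X Y -> cat_hom X Y -> Prop;
  cat_id : forall X, cat_hom X X;
  cat_comp : forall X Y Z, cat_hom Y Z -> cat_hom X Y -> cat_hom X Z;
  cat_eq_refl : forall X Y (f : cat_hom X Y), cat_eq f f;
  cat_eq_sym : forall X Y (f g : cat_hom X Y), cat_eq f g -> cat_eq g f;
  cat_eq_trans : forall X Y (f g h : cat_hom X Y),
    cat_eq f g -> cat_eq g h -> cat_eq f h;
  cat_comp_eq : forall X Y Z (g g' : cat_hom Y Z) (f f' : cat_hom X Y),
    cat_eq g g' -> cat_eq f f' -> cat_eq (cat_comp g f) (cat_comp g' f');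
  cat_compA : forall X Y Z T (h : cat_hom Z T) (g : cat_hom Y Z)
    (f : cat_hom X Y),
    cat_eq (cat_comp h (cat_comp g f)) (cat_comp (cat_comp h g) f);
  cat_idl : forall X Y (f : cat_hom X Y), cat_eq (cat_comp (cat_id Y) f) f;
  cat_idr : forall X Y (f : cat_hom X Y), cat_eq (cat_comp f (cat_id X)) f }.

Definition initial (C : category) (X : C) : Prop :=
  forall Y : C, exists h : cat_hom X Y, forall g : cat_hom X Y, cat_eq g h.

Section OreCategory.
Variables (Γ : groupType) (R : gradedRing Γ) (γ : Γ) (δ : grDer R γ).

Record ore_obj := OreObj {
  oo_ring :> gradedRing Γ;
  oo_map : grHom R oo_ring;
  oo_elt : oo_ring;
  oo_elt_comp : gr_comp oo_ring γ oo_elt;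
  oo_commutator : forall x : R,
    oo_elt * oo_map x - oo_map x * oo_elt = oo_map (δ x) }.

Record ore_hom (X Y : ore_obj) := OreHom {
  oh_hom :> grHom X Y;
  oh_map : oh_hom \o oo_map X =1 oo_map Y;
  oh_elt : oh_hom (oo_elt X) = oo_elt Y }.

Definition ore_hom_id (X : ore_obj) : ore_hom X X :=
  @OreHom X X (grHom_id X) (fun x => erefl) erefl.

Lemma ore_hom_o_map (X Y Z : ore_obj) (g : ore_hom Y Z) (f : ore_hom X Y) :
  grHom_o g f \o oo_map X =1 oo_map Z.
Proof.
move=> x; have /= fE := oh_map f x; have /= gE := oh_map g x.
by rewrite /= fE gE.
Qed.

Lemma ore_hom_o_elt (X Y Z : ore_obj) (g : ore_hom Y Z) (f : ore_hom X Y) :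
  grHom_o g f (oo_elt X) = oo_elt Z.
Proof. by rewrite /= oh_elt oh_elt. Qed.

Definition ore_hom_o (X Y Z : ore_obj) (g : ore_hom Y Z) (f : ore_hom X Y) :
    ore_hom X Z :=
  OreHom (ore_hom_o_map g f) (ore_hom_o_elt g f).

Lemma ore_hom_o_eq (X Y Z : ore_obj) (g g' : ore_hom Y Z) (f f' : ore_hom X Y) :
  g =1 g' -> f =1 f' -> ore_hom_o g f =1 ore_hom_o g' f'.
Proof. by move=> gg' ff' x /=; rewrite ff' gg'. Qed.

Definition ore_cat : category :=
  @Category ore_obj ore_hom (fun X Y f g => f =1 g) ore_hom_id ore_hom_o
    (fun X Y f => frefl f) (fun X Y f g => @fsym _ _ f g)
    (fun X Y f g h => @ftrans _ _ f g h) ore_hom_o_eq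
    (fun X Y Z T h g f => frefl _) (fun X Y f => frefl f)
    (fun X Y f => frefl f).

Definition ore_poly (γC : gr_cent R γ) : ore_cat :=
  OreObj (ore_var_comp γC δ) (ore_var_commutator γC δ).

End OreCategory.

(* Main.v *)
Require Import Defs.
From mathcomp Require Import all_boot all_algebra.
From HB Require Import structures.
From mathcomp Require Import finmap.
From mathcomp Require Import monalg.

(** Write t for the variable.  Every element of R[t; δ] is a unique finite sum
    of terms a t^k, so a ring homomorphism out of R[t; δ] is determined by its
    restriction φ to R and by the image u of t.  Conversely, for a pair (φ, u)
    with u φ(x) - φ(x) u = φ(δ x), the evaluation Σ a_k t^k ↦ Σ φ(a_k) u^k is
    multiplicative: the product of R[t; δ] is built from left multiplications
    by scalars and by t, and the evaluation turns these into left
    multiplications by φ(a) and by u ([skew_ev_fun_T]), the commutation relation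
    being exactly what makes the second case work.  It preserves degrees as
    soon as φ does and u has degree γ.  This is initiality.

    The three isomorphisms are evaluations:
    - for conjugate derivations, a ↦ ψ(a) and t ↦ t;
    - for δ + δ_r, a ↦ a and t ↦ t + r;
    - for matrices, A ↦ A and t ↦ the scalar matrix t.
    An isomorphism is a graded homomorphism that is bijective, so the inverse
    may be studied with the gradings forgotten.  In the first two cases it is
    again an evaluation, and uniqueness of homomorphisms with given values on R
    and t ([skew_rmorph_ext]) identifies the composites with the identity.  In
    the third case the evaluation only rearranges coefficients
    ([coef_skew_mx_eval]): the coefficient at t^k of the (i, j) entry of the
    image is the (i, j) entry of the coefficient at t^k. *)

Set Implicit Arguments.
Unset Strict Implicit.
Unset Printing Implicit Defensive.

Import GRing.Theory.
Local Open Scope ring_scope.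

(** * Evaluation of skew polynomials *)

Section Evaluation.
Variables (R S : pzRingType) (δ : derivation R).
Variables (φ : {rmorphism R -> S}) (u : S).
Local Notation P := (skew_poly δ).

Definition skew_ev_fun (p : P) : S := \sum_(k <- msupp p) φ p@_k * u ^+ k.

Lemma skew_ev_funEw (d : {fset nat}) (p : P) : (msupp p `<=` d)%fset ->
  skew_ev_fun p = \sum_(k <- d) φ p@_k * u ^+ k.
Proof.
move=> pd; apply: big_fset_incl => // k _ kp.
by rewrite mcoeff_outdom // raddf0 mul0r.
Qed.

Lemma skew_ev_funB : zmod_morphism skew_ev_fun.
Proof.
move=> p q; pose d := (msupp p `|` msupp q)%fset.
rewrite !(@skew_ev_funEw d) ?fsubsetUl ?fsubsetUr ?msuppB_le //.
rewrite -sumrB; apply: eq_bigr => k _.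
by rewrite mcoeffB raddfB mulrBl.
Qed.

HB.instance Definition _ := GRing.isZmodMorphism.Build P S skew_ev_fun
  skew_ev_funB.

Lemma skew_ev_funD : {morph skew_ev_fun : p q / p + q}.
Proof. exact: raddfD. Qed.

Lemma skew_ev_funU a k : skew_ev_fun (<< a *g k >> : P) = φ a * u ^+ k.
Proof. by rewrite (skew_ev_funEw msuppU_le) big_seq_fset1 mcoeffUU. Qed.

Lemma skew_ev_fun_Z a (p : P) : skew_ev_fun (skewZ a p) = φ a * skew_ev_fun p.
Proof.
elim/skew_ind: p => [|p q IHp IHq|b k].
- by rewrite skewZ0r raddf0 mulr0.
- by rewrite skewZDr !skew_ev_funD IHp IHq mulrDr.
- by rewrite skewZU !skew_ev_funU rmorphM mulrA.
Qed.

Hypothesis uφ : forall x, u * φ x - φ x * u = φ (δ x).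

(** On a term b t^k, moving t past b adds the term δ(b) t^k, just as moving u
    past φ(b) adds φ(δ b) = u φ(b) - φ(b) u. *)
Lemma skew_ev_fun_T (p : P) : skew_ev_fun (skewT p) = u * skew_ev_fun p.
Proof.
elim/skew_ind: p => [|p q IHp IHq|b k].
- by rewrite skewT0 raddf0 mulr0.
- by rewrite skewTD !skew_ev_funD IHp IHq mulrDr.
- rewrite skewTU skew_ev_funD !skew_ev_funU -uφ exprS mulrA -mulrDl.
  by rewrite addrC subrK mulrA.
Qed.

Lemma skew_ev_fun_monoid : monoid_morphism skew_ev_fun.
Proof.
split=> [|p q].
  by rewrite [LHS](skew_ev_funU 1 0) rmorph1 mulr1.
elim/skew_ind: p => [|p1 p2 IH1 IH2|a k].
- by rewrite !(mul0r, raddf0).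
- by rewrite mulrDl !skew_ev_funD IH1 IH2 mulrDl.
(* The product (a t^k) q is by definition a (t (... (t q))). *)
- rewrite [X in skew_ev_fun X](skew_mulU a k) skew_ev_fun_Z skew_ev_funU -mulrA.
  congr (_ * _); elim: k => [|k IH] /=; first by rewrite mul1r.
  by rewrite skew_ev_fun_T IH exprS mulrA.
Qed.

Definition skew_eval : {rmorphism P -> S} := HB.pack skew_ev_fun
  (GRing.isMonoidMorphism.Build P S skew_ev_fun skew_ev_fun_monoid).

Lemma skew_evalU a k : skew_eval (<< a *g k >> : P) = φ a * u ^+ k.
Proof. exact: skew_ev_funU. Qed.

Lemma skew_evalC a : skew_eval (skew_C δ a) = φ a.
Proof. by rewrite skew_evalU mulr1. Qed.

Lemma skew_evalX : skew_eval (skew_X δ) = u.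
Proof. by rewrite skew_evalU rmorph1 mul1r. Qed.

End Evaluation.

(** Uniqueness in the universal property: R and t generate R[t; δ]. *)
Lemma skew_rmorph_ext (R S : pzRingType) (δ : derivation R)
    (f g : {rmorphism skew_poly δ -> S}) :
  (forall a, f (skew_C δ a) = g (skew_C δ a)) ->
  f (skew_X δ) = g (skew_X δ) -> f =1 g.
Proof.
move=> fgC fgX p; rewrite [p]skew_polyE !rmorph_sum; apply: eq_bigr => k _.
by rewrite !rmorphM !rmorphXn fgC fgX.
Qed.

(** Being inverse to f on one side is an equality between two homomorphisms out
    of R[t; δ], hence a matter of R and t; it inverts an evaluation when used
    in both directions. *)
Lemma skew_rmorph_can (R S : pzRingType) (δ : derivation R)
    (f : {rmorphism skew_poly δ -> S}) (g : {rmorphism S -> skew_poly δ}) :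
  (forall a, g (f (skew_C δ a)) = skew_C δ a) ->
  g (f (skew_X δ)) = skew_X δ -> cancel f g.
Proof.
move=> gfC gfX; exact: (@skew_rmorph_ext _ _ _ (g \o f) idfun).
Qed.

(** * Initiality *)

Lemma gr_compX (Γ : groupType) (S : gradedRing Γ) (γ : Γ) (u : S) k :
  gr_comp S γ u -> gr_comp S (γ ^+ k)%g (u ^+ k).
Proof.
move=> Su; elim: k => [|k IH]; first exact: gr_comp1.
by rewrite exprS expgS; apply: gr_compM.
Qed.

Section GradedEvaluation.
Variables (Γ : groupType) (R : gradedRing Γ) (γ : Γ) (γC : gr_cent R γ).
Variables (δ : grDer R γ) (S : gradedRing Γ) (φ : grHom R S) (u : S).
Hypothesis Su : gr_comp S γ u.
Hypothesis uφ : forall x, u * φ x - φ x * u = φ (δ x).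

(** A coefficient at t^k of an element of degree τ has degree τ γ^-k, which
    the degree γ^k of u^k brings back to τ. *)
Lemma skew_eval_comp τ (p : gr_ore γC δ) :
  gr_comp (gr_ore γC δ) τ p -> gr_comp S τ (skew_eval uφ p).
Proof.
move=> Pp; apply: gr_comp_sum => k _ _.
rewrite -[τ](mulgVK (γ ^+ k)%g); apply: gr_compM; last exact: gr_compX.
exact/grHom_comp/Pp.
Qed.

Definition gr_eval : grHom (gr_ore γC δ) S := GrHom skew_eval_comp.

End GradedEvaluation.

Lemma ore_poly_initial (Γ : groupType) (R : gradedRing Γ) (γ : Γ)
    (γC : gr_cent R γ) (δ : grDer R γ) : initial (ore_poly δ γC).
Proof.
move=> [S φ u Su uφ].
have hC : gr_eval γC Su uφ \o oo_map (ore_poly δ γC) =1 φ.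
  exact: skew_evalC.
have hX : gr_eval γC Su uφ (oo_elt (ore_poly δ γC)) = u.
  exact: skew_evalX.
exists (@OreHom _ _ _ _ (ore_poly δ γC) (OreObj Su uφ) _ hC hX) => g.
apply: skew_rmorph_ext => [a|].
  by rewrite [RHS]skew_evalC; apply: (oh_map g).
by rewrite [RHS]skew_evalX; apply: (oh_elt g).
Qed.

(** * Conjugate derivations *)

Section Intertwining.
Variables (R : pzRingType) (δ1 δ2 : derivation R) (ψ : {rmorphism R -> R}).
Hypothesis ψδ : forall x, ψ (δ1 x) = δ2 (ψ x).

Lemma skew_map_commutator x :
  skew_X δ2 * (skew_C δ2 \o ψ) x - (skew_C δ2 \o ψ) x * skew_X δ2 =
  (skew_C δ2 \o ψ) (δ1 x).
Proof. by rewrite /= skew_XC addrAC subrr add0r ψδ. Qed.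

Definition skew_map : {rmorphism skew_poly δ1 -> skew_poly δ2} :=
  skew_eval skew_map_commutator.

Lemma skew_mapC a : skew_map (skew_C δ1 a) = skew_C δ2 (ψ a).
Proof. exact: skew_evalC. Qed.

Lemma skew_mapX : skew_map (skew_X δ1) = skew_X δ2.
Proof. exact: skew_evalX. Qed.

End Intertwining.

Lemma skew_map_can (R : pzRingType) (δ1 δ2 : derivation R)
    (ψ ψ' : {rmorphism R -> R}) (ψδ : forall x, ψ (δ1 x) = δ2 (ψ x))
    (ψδ' : forall x, ψ' (δ2 x) = δ1 (ψ' x)) :
  cancel ψ ψ' -> cancel (skew_map ψδ) (skew_map ψδ').
Proof.
move=> ψK; apply: skew_rmorph_can => [a|]; first by rewrite !skew_mapC ψK.
by rewrite !skew_mapX.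
Qed.

Lemma gr_ore_conjugate (Γ : groupType) (R : gradedRing Γ) (γ : Γ)
    (γC : gr_cent R γ) (δ1 δ2 : grDer R γ) :
  gr_conjugate δ1 δ2 -> gr_iso (gr_ore γC δ1) (gr_ore γC δ2).
Proof.
move=> [ψ [ψ' [ψK ψ'K δ2E]]].
pose ψi : {rmorphism R -> R} := HB.pack ψ'
  (GRing.isZmodMorphism.Build R R ψ' (can2_zmod_morphism ψK ψ'K))
  (GRing.isMonoidMorphism.Build R R ψ' (can2_monoid_morphism ψK ψ'K)).
have ψδ x : ψ (δ1 x) = δ2 (ψ x) by rewrite δ2E /= ψK.
have ψδ' x : ψi (δ2 x) = δ1 (ψi x) by rewrite δ2E /= ψK.
exists (@gr_eval _ _ _ γC δ1 (gr_ore γC δ2) (grHom_o (ore_incl γC δ2) ψ) _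
  (ore_var_comp γC δ2) (skew_map_commutator ψδ)).
by exists (skew_map ψδ'); apply: skew_map_can.
Qed.

(** * Adding an inner derivation *)

Section Translation.
Variables (R : pzRingType) (δ δ' : derivation R) (r : R).

(** Stated for any δ' with δ'(x) = δ(x) + r x - x r, so that exchanging the two
    derivations and negating r gives the inverse map. *)
Hypothesis δ'E : forall x, δ' x = δ x + (r * x - x * r).

Lemma skew_shift_commutator x :
  (skew_X δ + skew_C δ r) * skew_C δ x - skew_C δ x * (skew_X δ + skew_C δ r)
  = skew_C δ (δ' x).
Proof.
rewrite δ'E mulrDl mulrDr skew_XC -!rmorphM rmorphD rmorphB /=.
by rewrite -(addrA (_ * _)) [_ * _ + _]addrC addrKA addrA.
Qed.

Definition skew_shift : {rmorphism skew_poly δ' -> skew_poly δ} :=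
  skew_eval skew_shift_commutator.

Lemma skew_shiftC a : skew_shift (skew_C δ' a) = skew_C δ a.
Proof. exact: skew_evalC. Qed.

Lemma skew_shiftX : skew_shift (skew_X δ') = skew_X δ + skew_C δ r.
Proof. exact: skew_evalX. Qed.

End Translation.

Lemma skew_shift_can (R : pzRingType) (δ δ' : derivation R) (r s : R)
    (δ'E : forall x, δ' x = δ x + (r * x - x * r))
    (δE : forall x, δ x = δ' x + (s * x - x * s)) :
  s = - r -> cancel (skew_shift δ'E) (skew_shift δE).
Proof.
move=> sE; apply: skew_rmorph_can => [a|]; first by rewrite !skew_shiftC.
by rewrite skew_shiftX rmorphD skew_shiftC skew_shiftX sE raddfN addrNK.
Qed.

Lemma gr_ore_inner (Γ : groupType) (R : gradedRing Γ) (γ : Γ)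
    (γC : gr_cent R γ) (δ : grDer R γ) (r : R) (Rr : gr_comp R γ r) :
  gr_iso (gr_ore γC (add_grDer δ (inner_grDer γC Rr))) (gr_ore γC δ).
Proof.
set δ' := add_grDer _ _.
have δ'E x : δ' x = δ x + (r * x - x * r) by [].
have δE x : δ x = δ' x + ((- r) * x - x * (- r)).
  by rewrite δ'E mulNr mulrN -opprD addrK.
have Sr : gr_comp (gr_ore γC δ) γ (skew_X δ + skew_C δ r).
  by apply: (@gr_compD _ (gr_ore γC δ)); [exact: ore_var_comp | exact: skew_C_comp].
exists (@gr_eval _ _ _ γC δ' (gr_ore γC δ) (ore_incl γC δ) _ Sr
  (skew_shift_commutator δ'E)).
by exists (skew_shift δE); apply: skew_shift_can; rewrite ?opprK.
Qed.

(** * Matrices *)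

Section Matrices.
Variables (Γ : groupType) (R : gradedRing Γ) (γ : Γ) (γC : gr_cent R γ).
Variables (δ : grDer R γ) (n : nat).
Local Notation PM := (gr_ore (gr_mx_cent (n := n) γC) (mx_der n δ)).
Local Notation MP := (gr_mx (gr_ore γC δ) n).

Definition mx_incl_fun (A : gr_mx R n) : MP := map_mx (skew_C δ) A.

Lemma mx_incl_zmod : zmod_morphism mx_incl_fun.
Proof. exact: map_mxB. Qed.

Lemma mx_incl_monoid : monoid_morphism mx_incl_fun.
Proof. by split=> [|A B]; [apply: map_mx1 | apply: map_mxM]. Qed.

Definition mx_incl : {rmorphism gr_mx R n -> MP} := HB.pack mx_incl_fun
  (GRing.isZmodMorphism.Build (gr_mx R n) MP mx_incl_fun mx_incl_zmod)
  (GRing.isMonoidMorphism.Build (gr_mx R n) MP mx_incl_fun mx_incl_monoid).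

Lemma mx_incl_comp σ A : gr_comp (gr_mx R n) σ A -> gr_comp MP σ (mx_incl A).
Proof. by move=> RA i j; rewrite mxE; apply: skew_C_comp. Qed.

Definition gr_mx_incl : grHom (gr_mx R n) MP := GrHom mx_incl_comp.

Definition mx_var : MP := (skew_X δ)%:M.

Lemma mx_var_comp : gr_comp MP γ mx_var.
Proof.
move=> i j; rewrite mxE; case: eqP => _; last exact: gr_comp0.
exact: ore_var_comp.
Qed.

Lemma mx_varMl (B : MP) i j : (mx_var * B : 'M_n) i j = skew_X δ * B i j.
Proof.
rewrite [LHS]mxE (bigD1 i) //= mxE eqxx big1 ?addr0 // => k.
by rewrite eq_sym => /negPf ki; rewrite mxE ki mulr0n mul0r.
Qed.

Lemma mx_varMr (B : MP) i j : (B * mx_var : 'M_n) i j = B i j * skew_X δ.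
Proof.
rewrite [LHS]mxE (bigD1 j) //= mxE eqxx big1 ?addr0 // => k.
by move=> /negPf kj; rewrite mxE kj mulr0n mulr0.
Qed.

Lemma mx_var_commutator A :
  mx_var * gr_mx_incl A - gr_mx_incl A * mx_var = gr_mx_incl (mx_der n δ A).
Proof.
apply/matrixP => i j; rewrite mxE [X in _ + X]mxE mx_varMl mx_varMr !mxE.
by rewrite skew_XC addrAC subrr add0r.
Qed.

Definition skew_mx_eval : grHom PM MP :=
  gr_eval (gr_mx_cent (n := n) γC) mx_var_comp mx_var_commutator.

(** The scalar matrix t multiplies each entry separately, so the term A t^k
    goes to the matrix of the terms A_ij t^k. *)
Lemma skew_mx_evalU (A : 'M[R]_n) k i j :
  (skew_mx_eval << A *g k >> : 'M_n) i j = << A i j *g k >>.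
Proof.
rewrite [skew_mx_eval _]skew_evalU -skew_CX.
elim: k => [|k IH]; first by rewrite !mulr1 mxE.
by rewrite !exprSr !mulrA mx_varMr IH.
Qed.

(** A polynomial with matrix coefficients and a matrix of polynomials are the
    same doubly indexed family of elements of R; the evaluation is this
    identification, whence its bijectivity. *)
Lemma coef_skew_mx_eval (p : PM) i j k :
  ((skew_mx_eval p : 'M_n) i j : skew_poly δ)@_k = (p@_k : 'M_n) i j.
Proof.
elim/skew_ind: p => [|p q IHp IHq|A l].
- by rewrite raddf0 mxE !mcoeff0 mxE.
- by rewrite raddfD mxE !Defs.coefD IHp IHq mxE.
- by rewrite skew_mx_evalU !mcoeffU; case: eqP => _; rewrite // mxE.
Qed.

(** The inverse of the evaluation.  The union of the supports of the entries
    only serves to make the family of coefficients finitely supported. *)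
Definition mx_collect (B : MP) : PM :=
  [malg k in (\bigcup_(ij <- enum {: 'I_n * 'I_n}) msupp (B ij.1 ij.2))%fset
     => (\matrix_(i, j) (B i j)@_k : 'M[R]_n)].

Lemma coef_mx_collect (B : MP) i j k :
  ((mx_collect B)@_k : 'M_n) i j = (B i j)@_k.
Proof.
rewrite /mx_collect mcoeffE; case: ifPn => [_|kB]; rewrite mxE //.
apply/esym/mcoeff_outdom; apply: contra kB; apply/fsubsetP.
by apply: (bigfcup_sup (j := (i, j))); rewrite ?mem_enum.
Qed.

Lemma skew_mx_eval_bij : bijective skew_mx_eval.
Proof.
exists mx_collect => [p|B].
  apply: skewP => k; apply/matrixP => i j.
  by rewrite coef_mx_collect coef_skew_mx_eval.
apply/matrixP => i j; apply: skewP => k.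
by rewrite coef_skew_mx_eval coef_mx_collect.
Qed.

End Matrices.

Theorem theorem1p4 (Γ : groupType) (R : gradedRing Γ) (γ : Γ)
    (γC : gr_cent R γ) (δ : grDer R γ) :
  [/\ initial (ore_poly δ γC),
      forall δ1 δ2 : grDer R γ,
        gr_conjugate δ1 δ2 -> gr_iso (gr_ore γC δ1) (gr_ore γC δ2),
      forall (r : R) (Rr : gr_comp R γ r),
        gr_iso (gr_ore γC (add_grDer δ (inner_grDer γC Rr))) (gr_ore γC δ)
    & forall n : nat, (1 <= n)%N ->
        gr_iso (gr_ore (gr_mx_cent (n := n) γC) (mx_der n δ))
               (gr_mx (gr_ore γC δ) n)].
Proof.
split.
- exact: ore_poly_initial.
- exact: gr_ore_conjugate.
- exact: gr_ore_inner.
- by move=> n _; exists (skew_mx_eval γC δ n); apply: skew_mx_eval_bij.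
Qed.
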